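(* Let $p$ be an odd prime and $a,t\in\mathbb Z_p$ with $t\not\equiv 0,1\pmod p$. Then $$\sum_{k=0}^{p-1}\binom ak^2t^k\equiv t^{\langle a\rangle_p}\sum_{k=0}^{p-1}\frac{\binom ak^2}{t^k}\equiv(t-1)^{\langle a\rangle_p}P_{\langle a\rangle_p}\Big(\frac{t+1}{t-1}\Big)\equiv(t-1)^{\langle a\rangle_p}\sum_{k=0}^{p-1}\binom ak\binom{-1-a}k\frac1{(1-t)^k}\equiv(t-1)^{2\langle a\rangle_p}\sum_{k=0}^{p-1}\binom{-1-a}k^2t^k\pmod p.$$
   Context: For a prime $p$, $\mathbb Z_p$ is the set of rationals with denominator coprime to $p$; congruences mod $p$ are in $\mathbb Z_p$. For $a\in\mathbb Z_p$, $\langle a\rangle_p\in\{0,\dots,p-1\}$ with $a\equiv\langle a\rangle_p\pmod p$. For rational $a$, $\binom ak=a(a-1)\cdots(a-k+1)/k!$. $P_n$ is the Legendre polynomial ($P_0=1,P_1=x,(n+1)P_{n+1}=(2n+1)xP_n-nP_{n-1}$). *)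

(* Defs.v *)
From HB Require Import structures.
From mathcomp Require Import all_boot all_order all_algebra.
Set Implicit Arguments. Unset Strict Implicit. Unset Printing Implicit Defensive.
Import Order.TTheory GRing.Theory Num.Theory.
Local Open Scope ring_scope.

(* The ring Z_p of rationals with denominator coprime to p. *)
Definition p_integral (p : nat) : {pred rat} :=
  [pred x | coprime p `|denq x|%N].

(* Congruence modulo p in Z_p: both sides are required to lie in Z_p. *)
Definition congr_modp (p : nat) (x y : rat) : bool :=
  [&& x \in p_integral p, y \in p_integral p
    & (x - y) / p%:R \in p_integral p].

(* <a>_p; the value is p (junk) when a is not p-integral, see [residueP]. *)
Definition residue (p : nat) (a : rat) : nat :=
  find (fun r : nat => congr_modp p a r%:R) (iota 0 p).

Definition binq (a : rat) (k : nat) : rat :=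
  (\prod_(i < k) (a - i%:R)) / k`!%:R.

(* The pair (P_n, P_(n+1)). *)
Fixpoint legendre_pair (n : nat) : {poly rat} * {poly rat} :=
  if n is m.+1 then
    let: (q0, q1) := legendre_pair m in
    (q1, (m.+2)%:R^-1 *: ((2 * m.+1 + 1)%:R *: ('X * q1) - m.+1%:R *: q0))
  else (1, 'X).

Definition legendre (n : nat) : {poly rat} := (legendre_pair n).1.

Lemma legendre0 : legendre 0 = 1.
Proof. by []. Qed.

Lemma legendre1 : legendre 1 = 'X.
Proof. by []. Qed.

Lemma legendreS (n : nat) :
  n.+2%:R *: legendre n.+2 =
  (2 * n.+1 + 1)%:R *: ('X * legendre n.+1) - n.+1%:R *: legendre n.
Proof.
rewrite /legendre /=; case: (legendre_pair n) => q0 q1 /=.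
by rewrite scalerA divff ?scale1r // pnatr_eq0.
Qed.

Lemma p_integral_div (p : nat) (n d : int) :
  d != 0 -> coprime p `|d|%N -> n%:~R / d%:~R \in p_integral p.
Proof.
move=> dN0 cpd; rewrite /p_integral inE.
case: (divqP n d) dN0 cpd => [|k x kN0] // _.
by rewrite abszM coprimeMr => /andP[].
Qed.

Lemma residueP (p : nat) (a : rat) :
  prime p -> a \in p_integral p ->
  (residue p a < p)%N /\ congr_modp p a (residue p a)%:R.
Proof.
move=> p_pr ap; have p_gt0 := prime_gt0 p_pr.
have pN0 : p%:R != 0 :> rat by rewrite pnatr_eq0 -lt0n.
suff hasr : has (fun r : nat => congr_modp p a r%:R) (iota 0 p).
  have lt_r : (residue p a < p)%N by move: hasr; rewrite has_find size_iota.
  split=> //; have := nth_find 0%N hasr.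
  by rewrite -/(residue p a) nth_iota.
have dN0 : (denq a)%:~R != 0 :> rat by rewrite intr_eq0 denq_neq0.
have cpd : coprimez p (denq a) by rewrite coprimezE.
have [[u v] /= uv] := coprimezP _ _ cpd.
pose m := numq a * v; pose r := `|(m %% p)%Z|%N.
have pZ0 : (p : int) != 0 by rewrite eqz_nat -lt0n.
have rE : (r : int) = (m %% p)%Z by rewrite /r gez0_abs ?modz_ge0.
have r_lt : (r < p)%N by rewrite -ltz_nat rE ltz_pmod.
apply/hasP; exists r; first by rewrite mem_iota.
rewrite /congr_modp ap; apply/and3P; split=> //.
  have := p_integral_div r (oner_neq0 int) (coprimen1 p).
  by rewrite divr1.
pose w := numq a * u + (m %/ p)%Z * denq a.
suff -> : (a - r%:R) / p%:R = w%:~R / (denq a)%:~R.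
  exact: (p_integral_div w (denq_neq0 a) ap).
apply: (canLR (mulfK pN0)); rewrite mulrAC; apply: (canRL (mulfK dN0)).
rewrite mulrBl -[X in X * _ - _]divq_num_den divfK //.
rewrite -[r%:R]/((Posz r)%:~R) -[p%:R]/((Posz p)%:~R) -!intrM -intrB.
congr (_%:~R).
have mE : m = (m %/ p)%Z * p + r by rewrite rE -divz_eq.
have -> : (r : int) = m - (m %/ p)%Z * p by rewrite [X in X - _]mE addrAC subrr add0r.
rewrite -[X in X - _]mulr1 -uv /w mulrBl mulrDr mulrDl.
rewrite !mulrA -/m; move: (m %/ p)%Z => q.
by rewrite opprD opprK addrA addrK [q * p * _]mulrAC.
Qed.

(* Main.v *)
Require Import Defs.
From HB Require Import structures.
From mathcomp Require Import all_boot all_order all_algebra.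
From mathcomp Require Import ring zify.
Set Implicit Arguments. Unset Strict Implicit. Unset Printing Implicit Defensive.
Import Order.TTheory GRing.Theory Num.Theory.
Local Open Scope ring_scope.

(** Write [D_n(t)] for the sum of [binom(n,k)^2 t^k]. Over Q, Vandermonde gives
    [D_n(t) = (t-1)^n L_n(1/(t-1))] with
    [L_n(y) = sum_k binom(n,k) binom(n+k,k) y^k], and
    [L_n(y) = P_n(2y+1)] because both sides obey the same recurrence. With
    [n = <a>_p] one has [a = n] and [-1-a = m := p-1-n] modulo [p], so the first
    four expressions reduce to [D_n(t)]. The fourth sum without its prefactor is
    symmetric under [a <-> -1-a], so it is congruent both to [L_n(1/(t-1))] and
    to [L_m(1/(t-1))]; hence [(t-1)^(2n) D_m(t)] is congruent to
    [(t-1)^(p-1) D_n(t)], and Fermat's little theorem concludes. *)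

(** * Coefficients and recurrence of the shifted Legendre polynomials *)

Definition legendre_coef (n k : nat) : nat := ('C(n, k) * 'C(n + k, k))%N.

Definition shifted_legendre (n : nat) : {poly rat} :=
  \poly_(k < n.+1) (legendre_coef n k)%:R.

Lemma coef_shifted_legendre (n k : nat) :
  (shifted_legendre n)`_k = (legendre_coef n k)%:R.
Proof.
rewrite coef_poly; case: ltnP => // nk.
by rewrite /legendre_coef bin_small.
Qed.

(** Subtraction in the ring agrees with the truncated one for [k <= n]; beyond that both binomials
    vanish. *)
Lemma natr_mul_bin_left (R : pzRingType) (n k : nat) :
  k.+1%:R * 'C(n, k.+1)%:R = (n%:R - k%:R) * 'C(n, k)%:R :> R.
Proof.
rewrite -natrM mul_bin_left natrM; case: (leqP k n) => kn; first by rewrite natrB.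
by rewrite [in RHS]bin_small // bin_small // !mulr0.
Qed.

(** Each binomial of [legendre_coef] contributes one factor [k + 1], through
    [(k+1) C(n,k+1) = (n-k) C(n,k)] and [(k+1) C(n+k+1,k+1) = (n+k+1) C(n+k,k)]. *)
Lemma legendre_coefSr (R : comPzRingType) (n k : nat) :
  k.+1%:R ^+ 2 * (legendre_coef n k.+1)%:R
    = (n%:R - k%:R) * (n%:R + k%:R + 1) * (legendre_coef n k)%:R :> R.
Proof.
have := natr_mul_bin_left R n k.
have /(congr1 (fun m : nat => m%:R : R)) := mul_bin_diag (n + k.+1) k.
rewrite /legendre_coef !natrM addnS /= -addnS => h2 h1.
rewrite expr2 mulrACA h1 -h2 -addn1 !natrD; ring.
Qed.

(** The factor [n + 1] released by [(n+1-k) C(n+1,k) = (n+1) C(n,k)] is absorbed by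
    [(n+1) C(n+1+k,k) = (n+1+k) C(n+k,k)]. *)
Lemma legendre_coefSl (R : comPzRingType) (n k : nat) :
  (n%:R + 1 - k%:R) * (legendre_coef n.+1 k)%:R
    = (n%:R + 1 + k%:R) * (legendre_coef n k)%:R :> R.
Proof.
case: (leqP k n.+1) => kn; last first.
  by rewrite /legendre_coef bin_small // (bin_small (ltnW kn)) !mul0n !mulr0.
have /(congr1 (fun m : nat => m%:R : R)) := mul_bin_down n.+1 k.
have /(congr1 (fun m : nat => m%:R : R)) := mul_bin_down (n.+1 + k) k.
rewrite /legendre_coef addnK !addSn /= !natrM natrB // -addn1 -[n.+1]addn1.
rewrite !natrD [_ + k%:R + 1]addrAC => h2 h1.
by rewrite mulrA -h1 [RHS]mulrCA h2; ring.
Qed.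

(* Times [(j+1)^2], each term of the recurrence in degree [j+1] is a polynomial
   multiple of the coefficient [B] of degree [j] in [shifted_legendre n.+1]. *)
Lemma shifted_legendreS (n : nat) :
  n.+2%:R *: shifted_legendre n.+2 =
  (2 * n.+1 + 1)%:R *: ((2 *: 'X + 1) * shifted_legendre n.+1)
    - n.+1%:R *: shifted_legendre n.
Proof.
apply/polyP => -[|j]; rewrite mulrDl mul1r -scalerAl.
  rewrite !(coefB, coefZ, coefD, coefXM) /= !coef_shifted_legendre.
  rewrite /legendre_coef !bin0 -addn1 -[n.+1]addn1 !(natrD, natrM); ring.
rewrite !(coefB, coefZ, coefD, coefXM) /= !coef_shifted_legendre.
have jN0 : j.+1%:R ^+ 2 != 0 :> rat by rewrite expf_eq0 /= pnatr_eq0.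
apply: (mulfI jN0).
set B := (legendre_coef n.+1 j)%:R : rat.
(* In [h2] and [h0], lowering the degree by [legendre_coefSr] leaves exactly the factor with which
   [legendre_coefSl] moves the index to [n + 1]. *)
have h2 : j.+1%:R ^+ 2 * (legendre_coef n.+2 j.+1)%:R
          = (n%:R + j%:R + 3) * (n%:R + j%:R + 2) * B.
  rewrite legendre_coefSr -mulrA mulrCA.
  have -> : n.+2%:R - j%:R = n.+1%:R + 1 - j%:R :> rat by rewrite -natr1.
  by rewrite legendre_coefSl /B -!natr1; ring.
have h1 : j.+1%:R ^+ 2 * (legendre_coef n.+1 j.+1)%:R
          = (n%:R + 1 - j%:R) * (n%:R + j%:R + 2) * B.
  by rewrite legendre_coefSr /B -!natr1; ring.
have h0 : j.+1%:R ^+ 2 * (legendre_coef n j.+1)%:R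
          = (n%:R - j%:R) * (n%:R + 1 - j%:R) * B.
  rewrite legendre_coefSr -!mulrA legendre_coefSl; congr (_ * (_ * _)); ring.
rewrite mulrCA h2 mulrBr [X in _ = _ - X]mulrCA h0 [X in _ = X - _]mulrCA.
by rewrite [X in _ * X - _]mulrDr h1 !natrD !natrM -!natr1; ring.
Qed.

(** At [2y + 1] the recurrence of [legendre] becomes [shifted_legendreS]; it has order two, so the
    induction carries two consecutive indices. *)
Lemma legendre_shifted (n : nat) (y : rat) :
  (legendre n).[2 * y + 1] = (shifted_legendre n).[y].
Proof.
have [] // : (legendre n).[2 * y + 1] = (shifted_legendre n).[y] /\
  (legendre n.+1).[2 * y + 1] = (shifted_legendre n.+1).[y].
elim: n => [|n [IH0 IH1]].
  rewrite legendre0 legendre1 /shifted_legendre !horner_poly !big_ord_recr.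
  rewrite !big_ord0 /legendre_coef !hornerE /=; split=> //.
  by rewrite bin0 bin1; ring.
split=> //; have n2 : n.+2%:R != 0 :> rat by rewrite pnatr_eq0.
apply: (mulfI n2); rewrite -!hornerZ legendreS shifted_legendreS.
by rewrite !hornerE -IH0 -IH1; ring.
Qed.

(** * Sums of squared binomials over the rationals *)

Definition binom_sq_sum (n : nat) (x : rat) : rat :=
  \sum_(k < n.+1) 'C(n, k)%:R ^+ 2 * x ^+ k.

(** The coefficients are palindromic: reversing the sum fixes [C(n,k)^2] and turns [x^n x^-(n-k)]
    into [x^k]. *)
Lemma binom_sq_sum_inv (n : nat) (x : rat) :
  x != 0 -> x ^+ n * binom_sq_sum n x^-1 = binom_sq_sum n x.
Proof.
move=> x0; rewrite /binom_sq_sum mulr_sumr (reindex_inj rev_ord_inj) /=.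
apply: eq_bigr => k _; have kn : (k <= n)%N by rewrite -ltnS.
rewrite subSS bin_sub // mulrCA; congr (_ * _).
by rewrite exprVn -expfB_cond ?subKn ?(negPf x0) // leq_subr.
Qed.

(* 'C(n, k) 'C(k, j) = 'C(n, j) 'C(n - j, k - j), then Vandermonde. *)
Lemma sum_bin_mul (n j : nat) : (j <= n)%N ->
  (\sum_(k < n.+1) 'C(n, k) ^ 2 * 'C(k, j) = 'C(n, j) * 'C(n + (n - j), n))%N.
Proof.
move=> jn; rewrite -binomial.Vandermonde big_distrr /=.
rewrite (reindex_inj rev_ord_inj) [RHS](reindex_inj rev_ord_inj) /=.
apply: eq_bigr => k _; have kn : (k <= n)%N by rewrite -ltnS.
rewrite !subSS subKn // bin_sub // -mulnn.
rewrite mulnCA -mulnA; congr (_ * _)%N.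
case: (leqP j (n - k)%N) => jk; last first.
  have kj : (n - j < k)%N by lia.
  by rewrite (bin_small jk) (bin_small kj) !muln0.
(* Both sides are the trinomial coefficient [n! / (k! j! (n-k-j)!)]; they are compared after
   multiplication by its denominator. *)
have f0 : (0 < k`! * (j`! * (n - k - j)`!))%N by rewrite !muln_gt0 !fact_gt0.
apply/eqP; rewrite -(eqn_pmul2r f0); apply/eqP.
have e1 := bin_fact kn; have e2 := bin_fact jk; have e3 := bin_fact jn.
have kj : (k <= n - j)%N by lia.
have e4 := bin_fact kj; rewrite -subnDA addnC subnDA in e4.
transitivity (n`!).
  by rewrite -e1 -e2; ring.
by rewrite -e3 -e4; ring.
Qed.

(** Expanding [x^k = (1 + (x-1))^k] and exchanging sums, [sum_bin_mul] gives [(x-1)^j] the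
    coefficient [C(n,j) C(2n-j,n)], which is [legendre_coef n (n-j)]. *)
Lemma binom_sq_sum_shifted (n : nat) (x : rat) : x - 1 != 0 ->
  binom_sq_sum n x = (x - 1) ^+ n * (shifted_legendre n).[(x - 1)^-1].
Proof.
move=> x1; rewrite /binom_sq_sum /shifted_legendre horner_poly mulr_sumr.
rewrite [RHS](reindex_inj rev_ord_inj) /=.
under eq_bigr => k _.
  rewrite -[x in x ^+ k](subrK 1) [x - 1 + 1]addrC exprDn.
  (* Padding the inner sum with terms where ['C(k, i)] is zero makes its range independent of [k],
     ready for the exchange. *)
  rewrite (big_ord_widen n.+1 (fun i => (1 ^+ (k - i) * (x - 1) ^+ i) *+ 'C(k, i))) //.
  rewrite big_mkcond mulr_sumr.
  under eq_bigr => i _.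
    have -> : (if (i < k.+1)%N then (1 ^+ (k - i) * (x - 1) ^+ i) *+ 'C(k, i)
       else 0) = (x - 1) ^+ i * 'C(k, i)%:R.
      by case: ltnP => ik; [rewrite expr1n mul1r mulr_natr | rewrite bin_small ?mulr0].
    rewrite mulrCA -natrX -natrM.
    over.
  over.
rewrite exchange_big /=; apply: eq_bigr => j _.
have jn : (j <= n)%N by rewrite -ltnS.
rewrite -mulr_sumr -natr_sum sum_bin_mul // subSS /legendre_coef bin_sub //.
rewrite exprVn mulrCA -expfB_cond ?(negPf x1) ?leq_subr // subKn // mulrC.
by rewrite -(@bin_sub (n + (n - j)) n) ?leq_addr // addKn.
Qed.

(** * The ring of [p]-integral rationals and its congruences *)

(** Allows any fraction with denominator prime to [p], so that closure proofs need not compute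
    [denq]. *)
Lemma p_integralP (p : nat) (x : rat) :
  reflect (exists n d : int,
    [/\ d != 0, coprime p `|d|%N & x = n%:~R / d%:~R])
  (x \in p_integral p).
Proof.
apply: (iffP idP) => [px | [n [d [d0 pd ->]]]]; last exact: p_integral_div.
by exists (numq x), (denq x); rewrite denq_neq0 divq_num_den.
Qed.

Lemma p_integral_subring (p : nat) : subring_closed (p_integral p).
Proof.
have abs0 (d e : int) : d != 0 -> e != 0 -> coprime p `|d| -> coprime p `|e| ->
    d * e != 0 /\ coprime p `|(d * e)%R|.
  by move=> d0 e0 pd pe; rewrite mulf_neq0 // abszM coprimeMr pd pe.
split=> [|x y|x y]; first by rewrite inE coprimen1.
- move=> /p_integralP[n [d [d0 pd ->]]] /p_integralP[m [e [e0 pe ->]]].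
  have [de0 pde] := abs0 _ _ d0 e0 pd pe.
  apply/p_integralP; exists (n * e - m * d), (d * e); split=> //.
  have d0' : d%:~R != 0 :> rat by rewrite intr_eq0.
  have e0' : e%:~R != 0 :> rat by rewrite intr_eq0.
  by rewrite intrB !intrM; field; apply/andP.
- move=> /p_integralP[n [d [d0 pd ->]]] /p_integralP[m [e [e0 pe ->]]].
  have [de0 pde] := abs0 _ _ d0 e0 pd pe.
  apply/p_integralP; exists (n * m), (d * e); split=> //.
  by rewrite !intrM mulf_div.
Qed.

(** Opens the generic [rpred] lemmas to [p_integral p]. *)
HB.instance Definition _ (p : nat) :=
  GRing.isSubringClosed.Build rat (p_integral p) (p_integral_subring p).

Lemma p_integral_invn (p d : nat) :
  (0 < d)%N -> coprime p d -> d%:R^-1 \in p_integral p.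
Proof.
move=> d0 pd; apply/p_integralP; exists 1, (Posz d).
by rewrite eqz_nat -lt0n d0 mul1r.
Qed.

Lemma congr_refl (p : nat) (x : rat) : x \in p_integral p -> congr_modp p x x.
Proof. by move=> px; rewrite /congr_modp px subrr mul0r rpred0. Qed.

Lemma congr_sym (p : nat) (x y : rat) : congr_modp p x y -> congr_modp p y x.
Proof.
case/and3P=> px py h; rewrite /congr_modp px py /=.
by rewrite -opprB mulNr rpredN.
Qed.

Lemma congr_trans (p : nat) (y x z : rat) :
  congr_modp p x y -> congr_modp p y z ->
  congr_modp p x z.
Proof.
case/and3P=> px py xy /and3P[_ pz yz]; rewrite /congr_modp px pz /=.
by rewrite -(subrKA y) mulrDl rpredD.
Qed.

Lemma congrB (p : nat) (x y x' y' : rat) :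
  congr_modp p x x' -> congr_modp p y y' ->
  congr_modp p (x - y) (x' - y').
Proof.
case/and3P=> px px' hx /and3P[py py' hy]; rewrite /congr_modp !rpredB //=.
by rewrite opprD addrACA -opprD mulrBl rpredB.
Qed.

Lemma congrD (p : nat) (x y x' y' : rat) :
  congr_modp p x x' -> congr_modp p y y' ->
  congr_modp p (x + y) (x' + y').
Proof.
case/and3P=> px px' hx /and3P[py py' hy]; rewrite /congr_modp !rpredD //=.
by rewrite opprD addrACA mulrDl rpredD.
Qed.

Lemma congrM (p : nat) (x y x' y' : rat) :
  congr_modp p x x' -> congr_modp p y y' ->
  congr_modp p (x * y) (x' * y').
Proof.
case/and3P=> px px' hx /and3P[py py' hy].
rewrite /congr_modp (rpredM px py) (rpredM px' py') /=.
have -> : (x * y - x' * y') / p%:R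
    = (x - x') / p%:R * y + x' * ((y - y') / p%:R) by ring.
by rewrite rpredD // rpredM.
Qed.

Lemma congrX (p : nat) (x x' : rat) (n : nat) :
  congr_modp p x x' ->
  congr_modp p (x ^+ n) (x' ^+ n).
Proof.
move=> xx'; elim: n => [|n IHn]; first by rewrite !expr0 congr_refl ?rpred1.
by rewrite !exprS congrM.
Qed.

Lemma congr_sum (p n : nat) (F G : 'I_n -> rat) :
  (forall i, congr_modp p (F i) (G i)) ->
  congr_modp p (\sum_i F i) (\sum_i G i).
Proof.
move=> FG; elim/big_ind2: _ => // [|x y x' y']; last exact: congrD.
by rewrite congr_refl ?rpred0.
Qed.

Lemma congr_prod (p n : nat) (F G : 'I_n -> rat) :
  (forall i, congr_modp p (F i) (G i)) ->
  congr_modp p (\prod_i F i) (\prod_i G i).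
Proof.
move=> FG; elim/big_ind2: _ => // [|x y x' y']; last exact: congrM.
by rewrite congr_refl ?rpred1.
Qed.

(** For [k < p] the prime [p] does not divide [k!], so dividing by [k!] preserves the congruence of
    the numerators. *)
Lemma congr_binq (p : nat) (a b : rat) (k : nat) :
  prime p -> (k < p)%N -> congr_modp p a b ->
  congr_modp p (binq a k) (binq b k).
Proof.
move=> p_pr kp ab; apply: congrM.
  by apply: congr_prod => i; rewrite congrB ?congr_refl ?rpred_nat.
apply/congr_refl/p_integral_invn; rewrite ?fact_gt0 // prime_coprime //.
elim: k kp => [|k IHk] kp; first by rewrite dvdn1 neq_ltn prime_gt1 ?orbT.
by rewrite factS Euclid_dvdM // negb_or gtnNdvd // IHk // ltnW.
Qed.

Lemma congr_modn (p m n : nat) :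
  (0 < p)%N -> m = n %[mod p] ->
  congr_modp p m%:R n%:R.
Proof.
move=> p0 mn; rewrite /congr_modp !rpred_nat /=.
have pN0 : p%:R != 0 :> rat by rewrite pnatr_eq0 -lt0n.
rewrite (divn_eq m p) (divn_eq n p) mn !natrD !natrM opprD addrACA subrr addr0.
by rewrite -mulrBl mulfK // rpredB ?rpred_nat.
Qed.

(** An element of [Z_p] outside the ideal generated by [p] has numerator prime to [p], hence is a
    unit. *)
Lemma p_integralV (p : nat) (x : rat) :
  prime p -> x \in p_integral p -> ~~ congr_modp p x 0 ->
  x != 0 /\ x^-1 \in p_integral p.
Proof.
move=> p_pr px; rewrite /congr_modp px rpred0 subr0 /=.
have pN0 : p%:R != 0 :> rat by rewrite pnatr_eq0 -lt0n prime_gt0.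
have [n [d [d0 pd ->]]] := p_integralP _ _ px => hx.
have pn : coprime p `|n|%N.
  rewrite prime_coprime //; apply: contra hx => /dvdnP[m nE].
  (* From [|n| = m p] follows [(n / d) / p = sgz n * m / d], contradicting [hx]. *)
  apply/p_integralP; exists (sgz n * m), d; split=> //.
  rewrite mulrAC; congr (_ / _); apply: (canLR (mulfK pN0)).
  by rewrite -[p%:R]/((Posz p)%:~R) -intrM -mulrA -PoszM -nE -intEsg.
have n0 : n != 0.
  by apply: contraL pn => /eqP->; rewrite prime_coprime //= dvdn0.
split; first by rewrite mulf_neq0 ?invr_eq0 ?intr_eq0.
by rewrite invf_div; exact: p_integral_div.
Qed.

(** Fermat for the integer residue of [x] gives [x^p = x] modulo [p]; the unit [x] is then
    cancelled. *)
Lemma congr_fermat (p : nat) (x : rat) :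
  prime p -> x \in p_integral p -> ~~ congr_modp p x 0 ->
  congr_modp p (x ^+ p.-1) 1.
Proof.
move=> p_pr px x0; have [xN0 pxV] := p_integralV p_pr px x0.
have [_ xr] := residueP p_pr px.
have xp : congr_modp p (x ^+ p) x.
  apply: (congr_trans (congrX p xr)); apply: congr_trans (congr_sym xr).
  by rewrite -natrX congr_modn ?prime_gt0 ?fermat_little.
have xpE : x ^+ p = x ^+ p.-1 * x by rewrite -exprSr prednK ?prime_gt0.
by have := congrM xp (congr_refl pxV); rewrite xpE mulfK // divff.
Qed.

(** * Generalised binomials at integers, and reduction of the sums modulo [p] *)

Lemma binq_nat (n k : nat) : binq n%:R k = 'C(n, k)%:R.
Proof.
have kN0 m : m`!%:R != 0 :> rat by rewrite pnatr_eq0 -lt0n fact_gt0.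
rewrite /binq; apply: (canLR (mulfK (kN0 k))).
rewrite -natrM bin_ffact; elim: k => [|k IHk]; first by rewrite big_ord0 ffactn0.
rewrite big_ord_recr /= IHk ffactnSr natrM; case: (leqP k n) => kn.
  by rewrite natrB.
by rewrite ffact_small // !mul0r.
Qed.

(** The factors [-1-n, ..., -k-n] are the negatives of those of the falling factorial of [n + k] of
    length [k]. *)
Lemma binq_opp_nat (n k : nat) :
  binq (- 1 - n%:R) k = (- 1) ^+ k * 'C(n + k, k)%:R.
Proof.
have kN0 m : m`!%:R != 0 :> rat by rewrite pnatr_eq0 -lt0n fact_gt0.
rewrite /binq; apply: (canLR (mulfK (kN0 k))).
rewrite -mulrA -natrM bin_ffact.
elim: k => [|k IHk]; first by rewrite big_ord0 ffactn0 mulr1.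
rewrite big_ord_recr /= IHk addnS ffactSS natrM exprS -natr1 natrD; ring.
Qed.

(** At [a = n] the two binomials multiply to [(-1)^k legendre_coef n k], whose sign is absorbed by
    [- y]; terms with [n < k < p] vanish. *)
Lemma congr_shifted_legendre (p n : nat) (a y : rat) :
  prime p -> (n < p)%N -> congr_modp p a n%:R -> y \in p_integral p ->
  congr_modp p (\sum_(k < p) binq a k * binq (- 1 - a) k * (- y) ^+ k)
    (shifted_legendre n).[y].
Proof.
move=> p_pr np an py; rewrite /shifted_legendre horner_poly.
rewrite (big_ord_widen p (fun k => (legendre_coef n k)%:R * y ^+ k)) //.
rewrite [X in congr_modp _ _ X]big_mkcond /=; apply: congr_sum => k.
have -> : (if (k < n.+1)%N then (legendre_coef n k)%:R * y ^+ k else 0)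
    = binq n%:R k * binq (- 1 - n%:R) k * (- y) ^+ k.
  rewrite binq_nat binq_opp_nat [(- y) ^+ k]exprNn.
  case: ltnP => nk; last by rewrite bin_small // !mul0r.
  have sgn2 : (- 1) ^+ k * (- 1) ^+ k = 1 :> rat by rewrite -expr2 sqrr_sign.
  rewrite /legendre_coef natrM -[LHS]mul1r -[X in X * _ = _]sgn2; ring.
apply: congrM; last by rewrite congr_refl // rpredX // rpredN.
apply: congrM; apply: congr_binq => //; apply: congrB => //.
by rewrite congr_refl ?rpredN ?rpred1.
Qed.

Lemma congr_binom_sq_sum (p n : nat) (a t : rat) :
  prime p -> (n < p)%N -> congr_modp p a n%:R -> t \in p_integral p ->
  congr_modp p (\sum_(k < p) binq a k ^+ 2 * t ^+ k) (binom_sq_sum n t).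
Proof.
move=> p_pr np an pt; rewrite /binom_sq_sum.
rewrite (big_ord_widen p (fun k => 'C(n, k)%:R ^+ 2 * t ^+ k)) //.
rewrite [X in congr_modp _ _ X]big_mkcond /=; apply: congr_sum => k.
have -> : (if (k < n.+1)%N then 'C(n, k)%:R ^+ 2 * t ^+ k else 0)
    = binq n%:R k ^+ 2 * t ^+ k.
  by rewrite binq_nat; case: ltnP => // nk; rewrite bin_small // expr0n mul0r.
apply: congrM; last by rewrite congr_refl ?rpredX.
by apply: congrX; apply: congr_binq.
Qed.

(** * Comparison of the five expressions *)

Theorem theorem2p3 (p : nat) (a t : rat) :
  prime p -> odd p ->
  a \in p_integral p -> t \in p_integral p ->
  ~~ congr_modp p t 0 -> ~~ congr_modp p t 1 ->
  let r := residue p a in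
  let S1 := \sum_(k < p) binq a k ^+ 2 * t ^+ k in
  let S2 := t ^+ r * \sum_(k < p) binq a k ^+ 2 / t ^+ k in
  let S3 := (t - 1) ^+ r * (legendre r).[(t + 1) / (t - 1)] in
  let S4 := (t - 1) ^+ r *
            \sum_(k < p) binq a k * binq (- 1 - a) k * (1 / (1 - t) ^+ k) in
  let S5 := (t - 1) ^+ (2 * r) *
            \sum_(k < p) binq (- 1 - a) k ^+ 2 * t ^+ k in
  [/\ congr_modp p S1 S2, congr_modp p S2 S3,
      congr_modp p S3 S4 & congr_modp p S4 S5].
Proof.
move=> p_pr _ pa pt t0 t1 r S1 S2 S3 S4 S5.
have [rp ar] := residueP p_pr pa; rewrite -/r in rp ar.
have ps : t - 1 \in p_integral p by rewrite rpredB ?rpred1.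
have s0 : ~~ congr_modp p (t - 1) 0.
  apply: contra t1 => h; rewrite -[t](subrK 1) -[X in congr_modp _ _ X]add0r.
  by rewrite congrD // congr_refl ?rpred1.
have [tN0 ptV] := p_integralV p_pr pt t0.
have [sN0 psV] := p_integralV p_pr ps s0.
pose D := binom_sq_sum r t.
have h1 : congr_modp p S1 D by exact: congr_binom_sq_sum.
have h2 : congr_modp p S2 D.
  (* Modulo [p], [S2] is [t^r] times [binom_sq_sum r] at [t^-1]. *)
  rewrite /D -binom_sq_sum_inv // congrM ?congr_refl ?rpredX //.
  rewrite /S2; under eq_bigr do rewrite -exprVn.
  exact: congr_binom_sq_sum.
(* An equality in Q, since [(t+1)/(t-1) = 2/(t-1) + 1]. *)
have h3 : S3 = D.
  rewrite /D binom_sq_sum_shifted // -legendre_shifted; congr (_ * _.[_]).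
  by field.
pose T := \sum_(k < p) binq a k * binq (- 1 - a) k * (- (t - 1)^-1) ^+ k.
have hT : S4 = (t - 1) ^+ r * T.
  congr (_ * _); apply: eq_bigr => k _; congr (_ * _).
  by rewrite div1r -exprVn -invrN opprB.
have TD : congr_modp p S4 D.
  rewrite hT /D binom_sq_sum_shifted // congrM ?congr_refl ?rpredX //.
  exact: congr_shifted_legendre.
suff h5 : congr_modp p S5 S4.
  split; first exact: congr_trans h1 (congr_sym h2).
  - by rewrite h3.
  - by rewrite h3; apply: congr_sym.
  - exact: congr_sym.
pose m := (p.-1 - r)%N.
have mr : (m + r = p.-1)%N by rewrite subnK // -ltnS prednK // prime_gt0.
have mp : (m < p)%N.
  by rewrite (leq_ltn_trans (leq_subr _ _)) // ltn_predL prime_gt0.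
have am : congr_modp p (- 1 - a) m%:R.
  have pE : p%:R = m%:R + r%:R + 1 :> rat.
    by rewrite -natrD mr natr1 prednK // prime_gt0.
  have -> : m%:R = (p%:R - 1) - r%:R :> rat by rewrite pE; ring.
  apply: congrB => //; rewrite -[X in congr_modp _ X]add0r congrB //.
    by rewrite -[0]/(0%:R) congr_modn ?prime_gt0 // modnn mod0n.
  by rewrite congr_refl ?rpred1.
have hm : congr_modp p (\sum_(k < p) binq (- 1 - a) k ^+ 2 * t ^+ k)
    ((t - 1) ^+ m * T).
  apply: congr_trans (congr_binom_sq_sum p_pr mp am pt) _.
  rewrite binom_sq_sum_shifted // congrM ?congr_refl ?rpredX //.
  (* Applied to [-1-a], the lemma yields [T] with its two binomials swapped, because
     [-1-(-1-a) = a]. *)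
  apply: congr_sym; have := congr_shifted_legendre p_pr mp am psV.
  have -> : - 1 - (- 1 - a) = a by ring.
  by under eq_bigr do rewrite [binq (- 1 - a) _ * _]mulrC.
have pr : congr_modp p ((t - 1) ^+ (2 * r)) ((t - 1) ^+ (2 * r)).
  by rewrite congr_refl ?rpredX.
apply: congr_trans (congrM pr hm) _.
(* As [m + r = p - 1], the exponent [2r + m] splits into [p - 1], removed by Fermat, and the
   prefactor [r] of [S4]. *)
have -> : (t - 1) ^+ (2 * r) * ((t - 1) ^+ m * T) = (t - 1) ^+ p.-1 * S4.
  by rewrite hT -mr mul2n -addnn !exprD mulrACA [_ ^+ r * _ ^+ m]mulrC.
rewrite -[X in congr_modp _ _ X]mul1r congrM ?congr_fermat //.
by case/and3P: TD => pS4 _ _; rewrite congr_refl.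
Qed.
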